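(* Let $m,n,k\ge1$ be integers and let $A\in\mathbb{R}^{m\times n}$ with $r=\operatorname{rank}(A)$. For each $\epsilon>0$ let $E_2^{(\epsilon)},\dots,E_k^{(\epsilon)}\in\mathbb{R}^{m\times n}$ be matrices with $\|E_j^{(\epsilon)}\|_2<\epsilon$ for all $j=2,\dots,k$, and let \[ \widetilde M_\epsilon=[A,\,A+E_2^{(\epsilon)},\dots,A+E_k^{(\epsilon)}]\in\mathbb{R}^{m\times kn}. \] Then \[ \lim_{\epsilon\to0^+}\sigma_i(\widetilde M_\epsilon)=\sqrt{k}\,\sigma_i(A)\quad\text{for } i=1,\dots,r, \] and \[ \lim_{\epsilon\to0^+}\sigma_i(\widetilde M_\epsilon)=0\quad\text{for } i=r+1,\dots,\min(m,kn). \]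
   Context: $\|\cdot\|_2$ denotes the spectral (operator) norm of a matrix. For $X\in\mathbb{R}^{p\times q}$, $\sigma_1(X)\ge\dots\ge\sigma_{\min(p,q)}(X)\ge0$ are its singular values in non-increasing order, counted with multiplicity. Square brackets denote horizontal concatenation. *)

(* Defs.v *)
From HB Require Import structures.
From mathcomp Require Import all_boot all_order all_algebra.
From mathcomp Require Import all_classical all_reals all_analysis.
From mathcomp.real_closed Require polyrcf.
Set Implicit Arguments.
Unset Strict Implicit.
Unset Printing Implicit Defensive.
Import Order.TTheory GRing.Theory Num.Theory.
Import numFieldNormedType.Exports.
Local Open Scope ring_scope.
Local Open Scope classical_set_scope.

Definition norm2 (R : realType) (q : nat) (v : 'cV[R]_q) : R :=
  Num.sqrt (\sum_(i < q) v i ord0 ^+ 2).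

Definition spectral_norm (R : realType) (p q : nat) (X : 'M[R]_(p, q)) : R :=
  sup [set norm2 (X *m v) | v in [set v : 'cV[R]_q | norm2 v <= 1]].

(* [rootsR] lists each real root once, hence the [nseq]: every eigenvalue is
   repeated according to its algebraic multiplicity. *)
Definition eigenvals (R : realType) (n : nat) (M : 'M[R]_n) : seq R :=
  flatten [seq nseq (mup x (char_poly M)) x
          | x <- polyrcf.rootsR (char_poly M)].

(* X^T X has q eigenvalues; when p < q the q - p discarded by [take] are
   zeros. *)
Definition singular_values (R : realType) (p q : nat) (X : 'M[R]_(p, q)) :
    seq R :=
  take (minn p q) (sort >=%R [seq Num.sqrt x | x <- eigenvals (X^T *m X)]).

(* Indexed from 1: [sigma X i] is meaningful for 1 <= i <= minn p q. *)
Definition sigma (R : realType) (p q : nat) (X : 'M[R]_(p, q)) (i : nat) : R :=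
  nth 0 (singular_values X) i.-1.

Lemma sum_ord_const (k n : nat) : (\sum_(j < k) n = k * n)%N.
Proof. by rewrite sum_nat_const card_ord. Qed.

(* The cast identifies the width \sum_(j < k) n of [\mxrow] with k * n. *)
Definition hconcat (R : realType) (m n k : nat) (B : 'I_k -> 'M[R]_(m, n)) :
    'M[R]_(m, k * n) :=
  castmx (erefl m, sum_ord_const k n) (\mxrow_(j < k) B j).

(* [A, A + E 2, ..., A + E k]; the j-th block from 0 carries E (j + 1), and
   E 0, E 1 are not used. *)
Definition perturbed_concat (R : realType) (m n k : nat) (A : 'M[R]_(m, n))
    (E : nat -> 'M[R]_(m, n)) : 'M[R]_(m, k * n) :=
  hconcat (fun j : 'I_k => if j == 0%N :> nat then A else A + E j.+1).

(* Main.v *)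
(** By the spectral theorem, a Hermitian matrix B has at least i eigenvalues
    >= t exactly when the quadratic form of B dominates t|v|^2 on some subspace
    of dimension i.  This makes the i-th largest eigenvalue Lipschitz in the
    entries of B, hence sigma_i, the square root of the i-th eigenvalue of the
    Gram matrix, is continuous, and the limits are the singular values of
    [A, ..., A] = A J with J = [I, ..., I].  As J J^T = k I, the maps v |-> v J
    and w |-> w J^T carry the subspaces witnessing t for A^T A to subspaces
    witnessing k t for (A J)^T (A J), and back. *)
Require Import Defs.
From HB Require Import structures.
From mathcomp Require Import all_boot all_order all_algebra.
From mathcomp Require Import spectral ring.
From mathcomp.real_closed Require Import complex.
From mathcomp.real_closed Require polyrcf.
From mathcomp Require Import all_classical all_reals all_analysis.
Set Implicit Arguments.
Unset Strict Implicit.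
Unset Printing Implicit Defensive.
Import Order.TTheory GRing.Theory Num.Theory.
Import numFieldNormedType.Exports.
Local Open Scope ring_scope.
Local Open Scope classical_set_scope.
Local Open Scope sesquilinear_scope.

(** * Hermitian forms and Rayleigh quotients on subspaces *)

Section HermitianForm.
Variable C : numClosedFieldType.

(** Vectors are rows, so that subspaces are row spaces; [hform 1%:M v] serves as |v|^2
    throughout. *)
Definition hform n (B : 'M[C]_n) (v : 'rV[C]_n) : C := (v *m B *m v^t*) 0 0.

Lemma hform_mul p n (B : 'M[C]_n) (Q : 'M[C]_(p, n)) v :
  hform B (v *m Q) = hform (Q *m B *m Q^t*) v.
Proof. by rewrite /hform trmx_mul map_mxM !mulmxA. Qed.

Lemma hformE n (B : 'M[C]_n) v :
  hform B v = \sum_j \sum_i v 0 i * B i j * (v 0 j)^*.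
Proof.
by rewrite /hform mxE; apply: eq_bigr => j _; rewrite !mxE mulr_suml.
Qed.

Lemma hform_diag n (d v : 'rV[C]_n) :
  hform (diag_mx d) v = \sum_j d 0 j * `|v 0 j| ^+ 2.
Proof.
rewrite /hform mxE; apply: eq_bigr => j _.
by rewrite mul_mx_diag !mxE normCK mulrAC mulrC mulrA.
Qed.

Lemma hform1 n (v : 'rV[C]_n) : hform 1%:M v = \sum_j `|v 0 j| ^+ 2.
Proof.
rewrite -diag_const_mx hform_diag.
by apply: eq_bigr => j _; rewrite mxE mul1r.
Qed.

Lemma hform1_ge0 n (v : 'rV[C]_n) : 0 <= hform 1%:M v.
Proof. by rewrite hform1 sumr_ge0 // => j _; rewrite exprn_ge0. Qed.

Lemma hform1_gt0 n (v : 'rV[C]_n) : (0 < hform 1%:M v) = (v != 0).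
Proof.
rewrite lt_neqAle hform1_ge0 andbT eq_sym; congr (~~ _).
rewrite hform1 psumr_eq0 => [|j _]; last exact: exprn_ge0.
apply/allP/eqP => [v0|-> j _]; last by rewrite mxE normr0 expr0n eqxx.
apply/rowP => j; rewrite mxE; apply/eqP.
by have := v0 j (mem_index_enum j); rewrite expf_eq0 normr_eq0.
Qed.

(* [B] has Rayleigh quotients >= [t] on an i-dimensional subspace, given by the
   rows of [W]; [x *m W != 0] expresses that these are independent. *)
Definition rayleigh_ge n (B : 'M[C]_n) (i : nat) (t : C) :=
  exists W : 'M[C]_(i, n), forall x : 'rV[C]_i, x != 0 ->
    x *m W != 0 /\ t * hform 1%:M (x *m W) <= hform B (x *m W).

Lemma exists_left_kernel p q (M : 'M[C]_(p, q)) :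
  (\rank M < p)%N -> exists2 x : 'rV[C]_p, x != 0 & x *m M = 0.
Proof.
move=> rM; have : kermx M != 0.
  by rewrite -mxrank_eq0 mxrank_ker subn_eq0 -ltnNge.
case/rowV0Pn => x /sub_kermxP xM x0; by exists x.
Qed.

(** In an orthonormal eigenbasis the form is a weighted sum of squares. If fewer than [i]
    eigenvalues are >= [t], an i-dimensional space meets the span of the other eigenvectors, where
    the form is < t|v|^2; conversely [i] eigenvectors with eigenvalue >= [t] span a witness. *)
Lemma rayleigh_geP n (B : 'M[C]_n) i t : B \is hermsymmx -> t \is Num.real ->
  rayleigh_ge B i t <-> (i <= #|[pred j | (t <= spectral_diag B 0 j)%R]|)%N.
Proof.
move=> Bh tr; set d := spectral_diag B; set P := spectralmx B.
have PU : P \is unitarymx by exact: spectral_unitarymx.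
have PPt : P *m P^t* = 1%:M by exact/unitarymxP.
have PtP : P^t* *m P = 1%:M by exact: mulmx1C.
have dr j : d 0 j \is Num.real.
  exact: (mxOverP (hermitian_spectral_diag_real Bh)).
have BE : B = P^t* *m diag_mx d *m P.
  rewrite -invmx_unitary //; exact/orthomx_spectralP/hermitian_normalmx.
set J := [pred j | _].
have formE u : hform B (u *m P) = \sum_j d 0 j * `|u 0 j| ^+ 2.
  rewrite hform_mul BE !mulmxA PPt mul1mx -mulmxA PPt mulmx1.
  exact: hform_diag.
have form1E (u : 'rV_n) : hform 1%:M (u *m P) = \sum_j `|u 0 j| ^+ 2.
  by rewrite hform_mul mulmx1 PPt hform1.
split => [[W HW]|le_i].
- rewrite leqNgt; apply/negP => lt_i.
  (* A vector of the row space of [W] with no component along the fewer than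
     [i] eigenvectors with eigenvalue >= [t]. *)
  pose S := colsub (enum_val : 'I_#|J| -> 'I_n) (W *m P^t*).
  have [|x x0 xS] := @exists_left_kernel _ _ S.
    exact: leq_ltn_trans (rank_leq_col _) lt_i.
  have [] := HW x x0; set u := x *m W *m P^t*.
  have uJ j : j \in J -> u 0 j = 0.
    move=> jJ; have /rowP/(_ (enum_rank_in jJ j)) := xS.
    rewrite [RHS]mxE => <-; rewrite /u -mulmxA !mxE.
    by apply: eq_bigr => a _; rewrite [S _ _]mxE enum_rankK_in.
  have uP : u *m P = x *m W by rewrite /u -mulmxA PtP mulmx1.
  rewrite -uP => uP0; rewrite formE form1E mulr_sumr => le_tu.
  have u0 : u != 0 by apply: contraNneq uP0 => ->; rewrite mul0mx.
  have [j uj0] : exists j, u 0 j != 0.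
    by apply/rV0Pn.
  (* On the support of [u] every eigenvalue is < [t]; the nonzero coordinate [j] makes the
     inequality strict. *)
  have: \sum_j d 0 j * `|u 0 j| ^+ 2 < \sum_j t * `|u 0 j| ^+ 2.
    rewrite (bigD1 j) //= [ltRHS](bigD1 j) //= ltr_leD //.
      rewrite ltr_pM2r ?exprn_gt0 ?normr_gt0 //.
      rewrite real_ltNge //; apply/negP => /uJ; exact/eqP.
    apply: ler_sum => a _; have [/uJ->|] := boolP (a \in J).
      by rewrite normr0 expr0n !mulr0.
    by rewrite inE -real_ltNge // => /ltW ta; rewrite ler_wpM2r ?exprn_ge0.
  by move=> /lt_geF; rewrite le_tu.
- have inj : injective (fun a : 'I_i => enum_val (widen_ord le_i a) : 'I_n).
    by move=> a b /enum_val_inj/(congr1 val)/= /val_inj.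
  set f := fun a : 'I_i => _ in inj.
  have fJ a : t <= d 0 (f a) by have := enum_valP (widen_ord le_i a).
  exists (rowsub f P) => x x0.
  (* Coordinates of the vector in the full eigenbasis: [x] placed at the indices [f a], zero
     elsewhere. *)
  pose u := x *m rowsub f 1%:M.
  have uE a : u 0 (f a) = x 0 a.
    rewrite mxE (bigD1 a) //= big1 ?addr0 => [|b ba].
      by rewrite !mxE eqxx mulr1.
    by rewrite !mxE (inj_eq inj) (negPf ba) mulr0.
  have u0 j : (forall a, f a != j) -> u 0 j = 0.
    by move=> fj; rewrite mxE big1 // => b _; rewrite !mxE (negPf (fj b)) mulr0.
  have -> : x *m rowsub f P = u *m P.
    by rewrite /u -mulmxA mul_rowsub_mx mul1mx.
  split.
    apply: contraNneq x0 => uP0; apply/eqP/rowP => a.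
    have : u *m P *m P^t* = 0 by rewrite uP0 mul0mx.
    by rewrite -mulmxA PPt mulmx1 -uE => ->; rewrite !mxE.
  rewrite formE form1E mulr_sumr ler_sum // => j _.
  have [/existsP[a /eqP<-]|/existsPn/u0->] := boolP [exists a, f a == j].
    by rewrite ler_wpM2r ?exprn_ge0.
  by rewrite normr0 expr0n !mulr0.
Qed.

Lemma hformD n (B D : 'M[C]_n) v : hform (B + D) v = hform B v + hform D v.
Proof. by rewrite /hform mulmxDr mulmxDl mxE. Qed.

Lemma hformN n (B : 'M[C]_n) v : hform (- B) v = - hform B v.
Proof. by rewrite /hform mulmxN mulNmx mxE. Qed.

Lemma hform0 n (B : 'M[C]_n) : hform B 0 = 0.
Proof. by rewrite /hform !mul0mx mxE. Qed.

Lemma hformZ n a (B : 'M[C]_n) v : hform (a *: B) v = a * hform B v.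
Proof. by rewrite /hform -scalemxAr -scalemxAl mxE. Qed.

Lemma hformZr n a (B : 'M[C]_n) v : hform B (a *: v) = `|a| ^+ 2 * hform B v.
Proof.
rewrite /hform linearZ /= map_mxZ -!scalemxAl -scalemxAr scalerA mxE.
by rewrite normCK.
Qed.

Lemma hform_real n (B : 'M[C]_n) v : B \is hermsymmx -> hform B v \is Num.real.
Proof.
move=> /is_hermitianmxP; rewrite expr0 scale1r => BE; apply/CrealP.
rewrite /hform.
have -> : forall M : 'M[C]_1, (M 0 0)^* = M^t* 0 0 by move=> M; rewrite !mxE.
by rewrite !trmx_mul !map_mxM trmxCK -BE mulmxA.
Qed.

Lemma hform_mul_gram n N (B : 'M[C]_n) (J : 'M[C]_(n, N)) v :
  hform (J^t* *m B *m J) v = hform B (v *m J^t*).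
Proof. by rewrite hform_mul trmxCK. Qed.

Lemma hform_gram m n (X : 'M[C]_(m, n)) v :
  hform (X^t* *m X) v = hform 1%:M (v *m X^t*).
Proof. by rewrite hform_mul mulmx1 trmxCK. Qed.

(** By |v_i||v_j| <= (|v_i|^2 + |v_j|^2)/2; summing over both indices yields n|v|^2. *)
Lemma norm_hform_le n (D : 'M[C]_n) (e : C) v :
  (forall i j, `|D i j| <= e) -> `|hform D v| <= n%:R * e * hform 1%:M v.
Proof.
move=> De; rewrite hformE hform1.
apply: le_trans (ler_norm_sum _ _ _) _.
apply: (@le_trans _ _
    (\sum_j \sum_i 2^-1 * e * (`|v 0 i| ^+ 2 + `|v 0 j| ^+ 2))).
  apply: ler_sum => j _; apply: le_trans (ler_norm_sum _ _ _) _.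
  apply: ler_sum => i _; rewrite !normrM norm_conjC.
  have e0 : 0 <= e by exact: le_trans (De i j).
  rewrite mulrAC [leRHS]mulrAC mulrC [leRHS]mulrC.
  rewrite ler_pM ?normr_ge0 ?mulr_ge0 //.
  rewrite ler_pdivlMl ?ltr0n // mulr_natl -subr_ge0.
  have -> : `|v 0 i| ^+ 2 + `|v 0 j| ^+ 2 - (`|v 0 i| * `|v 0 j|) *+ 2
    = (`|v 0 i| - `|v 0 j|) ^+ 2 by rewrite sqrrB addrAC.
  by rewrite -realEsqr rpredB ?normr_real.
under eq_bigr => j _ do rewrite -mulr_sumr big_split /= sumr_const card_ord.
rewrite -mulr_sumr big_split /= sumr_const card_ord sumrMnl -mulr2n.
set s := \sum_(i < n) _.
by rewrite le_eqVlt; apply/orP; left; apply/eqP; field.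
Qed.

(** The same subspace serves, since the two forms differ on it by at most n e |v|^2. *)
Lemma rayleigh_ge_perturb n (B B' : 'M[C]_n) (e t : C) i :
  B \is hermsymmx -> B' \is hermsymmx -> (forall i j, `|B i j - B' i j| <= e) ->
  rayleigh_ge B i t -> rayleigh_ge B' i (t - n%:R * e).
Proof.
move=> Bh B'h BB' [W HW]; exists W => x /HW[xW0 le_t]; split => //.
set v := x *m W in xW0 le_t *.
have : hform (B - B') v <= n%:R * e * hform 1%:M v.
  apply: le_trans (real_ler_norm _) (norm_hform_le _ _).
    by rewrite hformD hformN rpredB // hform_real.
  by move=> a b; rewrite !mxE.
rewrite hformD hformN mulrBl lerBlDr => le_D.
by rewrite lerBlDl; exact: le_trans le_t le_D.
Qed.

(** Passing from v to vJ multiplies the squared norm by k and the form by k^2, hence the quotient by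
    k. *)
Lemma rayleigh_ge_blowup n N (B : 'M[C]_n) (J : 'M[C]_(n, N)) (k t : C) i :
  0 < k -> J *m J^t* = k%:M ->
  rayleigh_ge B i t -> rayleigh_ge (J^t* *m B *m J) i (k * t).
Proof.
move=> k0 JJ [W HW]; exists (W *m J) => x /HW[]; rewrite mulmxA.
set v := x *m W => v0 le_t; split.
  apply: contraNneq v0 => vJ0; have : v *m J *m J^t* = 0 by rewrite vJ0 mul0mx.
  by rewrite -mulmxA JJ mul_mx_scalar => /eqP; rewrite scaler_eq0 gt_eqF.
rewrite [hform 1%:M _]hform_mul mulmx1 JJ -[k%:M]scalemx1 hformZ.
rewrite hform_mul_gram -mulmxA JJ mul_mx_scalar hformZr.
rewrite (ger0_norm (ltW k0)) expr2 -mulrA mulrCA -[leRHS]mulrA.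
by rewrite mulrCA [t * (k * _)]mulrCA !ler_pM2l.
Qed.

(** Here |w J^*|^2 <= k|w|^2, and t > 0 turns this into the bound on the quotient. It also gives
    independence: w J^* = 0 would make the form vanish at w, against t|w|^2 > 0. *)
Lemma rayleigh_ge_blowup_inv n N (B : 'M[C]_n) (J : 'M[C]_(n, N)) (k t : C) i :
  0 < k -> J *m J^t* = k%:M -> 0 < t ->
  rayleigh_ge (J^t* *m B *m J) i t -> rayleigh_ge B i (t / k).
Proof.
move=> k0 JJ t0 [W HW]; exists (W *m J^t*) => x /HW[]; rewrite mulmxA.
set w := x *m W => w0.
rewrite hform_mul_gram => le_t.
have le_v : hform 1%:M (w *m J^t*) <= k * hform 1%:M w.
  rewrite -ler_pdivrMl // -subr_ge0.
  (* [Q] is an orthogonal projection, and [|w Q|^2 = |w|^2 - |w J^*|^2 / k]. *)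
  pose Q := 1%:M - k^-1 *: (J^t* *m J).
  have Qh : Q^t* = Q.
    rewrite /Q linearB /= linearZ /= trmx1 trmx_mul map_mxB map_mxZ map_mxM.
    by rewrite map_mx1 trmxCK /= (CrealP _) // rpredV gtr0_real.
  have QQ : Q *m Q = Q.
    rewrite {1}/Q mulmxBl mul1mx -scalemxAl /Q mulmxBr mulmx1 -scalemxAr.
    rewrite -mulmxA [J *m (_ *m _)]mulmxA JJ mul_scalar_mx -scalemxAr scalerA.
    by rewrite mulVf ?gt_eqF // scale1r subrr scaler0 subr0.
  have <- : hform 1%:M (w *m Q)
    = hform 1%:M w - k^-1 * hform 1%:M (w *m J^t*).
    by rewrite hform_mul mulmx1 Qh QQ hformD hformN hformZ hform_gram.
  exact: hform1_ge0.
split; last first.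
  apply: le_trans le_t; rewrite -mulrA ler_pM2l //.
  by rewrite ler_pdivrMl.
apply: contraTneq le_t => ->.
by rewrite hform0 lt_geF // mulr_gt0 // hform1_gt0.
Qed.

(** A witness of dimension above the rank contains a nonzero vector killed by X^*, where the form is
    0. *)
Lemma rayleigh_ge_rank m n (X : 'M[C]_(m, n)) i t :
  0 < t -> rayleigh_ge (X^t* *m X) i t -> (i <= \rank X)%N.
Proof.
move=> t0 [W HW]; rewrite leqNgt; apply/negP => lt_r.
have [|x x0 xW] := @exists_left_kernel _ _ (W *m X^t*).
  apply: leq_ltn_trans (mxrankM_maxr _ _) _.
  by rewrite mxrank_map mxrank_tr.
have [xW0] := HW x x0; rewrite hform_gram -mulmxA xW.
by rewrite hform0 lt_geF // mulr_gt0 // hform1_gt0.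
Qed.

Lemma rayleigh_ge_gram0 m n (X : 'M[C]_(m, n)) i :
  (i <= n)%N -> rayleigh_ge (X^t* *m X) i 0.
Proof.
move=> le_in; exists (pid_mx i) => x x0; rewrite mul0r hform_gram hform1_ge0.
split => //; apply: contraNneq x0 => xp0.
have : x *m (pid_mx i : 'M[C]_(i, n)) *m pid_mx i = 0 :> 'rV[C]_i.
  by rewrite xp0 mul0mx.
by rewrite -mulmxA mul_pid_mx minnn (minn_idPr le_in) pid_mx_1 mulmx1 => ->.
Qed.

End HermitianForm.

(** * Eigenvalues and singular values of real matrices *)

(** In a decreasing list the entries >= [t] form an initial segment. *)
Lemma nth_sort_ge (R : realDomainType) (s : seq R) t i : (i < size s)%N ->
  (t <= nth 0 (sort >=%R s) i) = (i < count (>= t)%R s)%N.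
Proof.
rewrite -(size_sort >=%R) -(count_sort >=%R).
have := sort_sorted (@ge_total _ R) s.
elim: (sort _ s) i => // x l IHl i; rewrite /= path_sortedE; last first.
  exact: ge_trans.
move=> /andP[/allP lx sl].
have [tx|xt] /= := leP t x.
  by case: i => [|i] //=; rewrite !ltnS => il; rewrite IHl.
have c0 : count (>= t)%R l = 0%N.
  apply/eqP; rewrite -leqn0 leqNgt -has_count; apply/hasPn => y /lx yx.
  by rewrite /= -ltNge (le_lt_trans yx).
rewrite c0 add0n; case: i => [|i il] //=; first by rewrite lt_geF.
by apply: lt_geF; apply: le_lt_trans xt; apply: lx; exact: mem_nth.
Qed.

Lemma char_poly_conj (F : fieldType) n (P A : 'M[F]_n) : P \in unitmx ->
  char_poly (invmx P *m A *m P) = char_poly A.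
Proof.
move=> Pu; rewrite /char_poly /char_poly_mx !map_mxM.
have VP : map_mx polyC (invmx P) *m map_mx polyC P = 1%:M.
  by rewrite -map_mxM mulVmx //; exact: map_mx1.
have {1}-> : 'X%:M = map_mx polyC (invmx P) *m 'X%:M *m map_mx polyC P
    :> 'M[{poly F}]_n by rewrite mul_mx_scalar -scalemxAl VP scalemx1.
rewrite -mulmxBl -mulmxBr !det_mulmx mulrC mulrA.
by rewrite -det_mulmx (mulmx1C VP) det1 mul1r.
Qed.

(* The library's spectral theorem is for algebraically closed fields, so real
   symmetric matrices are embedded in the complex ones. *)
Section RealSymmetric.
Variable R : realType.
Local Notation toC := (map_mx (real_complex R)).

Lemma toC_conj m n (X : 'M[R]_(m, n)) : toC X ^t* = toC X^T.
Proof.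
by apply/matrixP => i j; rewrite !mxE; apply/CrealP; rewrite complex_real.
Qed.

Lemma toC_hermsym n (M : 'M[R]_n) : M^T = M -> toC M \is hermsymmx.
Proof.
by move=> MT; apply/is_hermitianmxP; rewrite expr0 scale1r toC_conj MT.
Qed.

Lemma eigenvals_spectral n (M : 'M[R]_n) : M^T = M ->
  perm_eq (eigenvals M)
    [seq complex.Re (spectral_diag (toC M) 0 j) | j <- enum 'I_n].
Proof.
move=> MT; set d := spectral_diag _; set s := map _ _.
have Mh := toC_hermsym MT.
have charM : char_poly M = \prod_(x <- s) ('X - x%:P).
  apply: (@map_poly_inj _ _ (real_complex R)).
  rewrite map_char_poly rmorph_prod big_map.
  have -> : char_poly (toC M) = char_poly (diag_mx d).
    rewrite {1}(orthomx_spectralP (hermitian_normalmx Mh)) char_poly_conj //.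
    exact: spectral_unit.
  rewrite char_poly_trig ?diag_mx_is_trig // -big_enum; apply: eq_bigr => j _.
  rewrite rmorphB /= map_polyX map_polyC /= mxE eqxx mulr1n.
  by rewrite RRe_real // (mxOverP (hermitian_spectral_diag_real Mh)).
have char0 : char_poly M != 0 by exact/monic_neq0/char_poly_monic.
(* Compare multiplicities: since the characteristic polynomial splits as the product over [s], the
   count of [x] in [s] is its multiplicity as a root. *)
apply/allP => x _ /=; apply/eqP.
rewrite -[RHS]mu_prod_XsubC -charM /eigenvals.
rewrite count_flatten -map_comp.
have urs : uniq (polyrcf.rootsR (char_poly M)) by exact: polyrcf.uniq_roots.
under eq_map => y do rewrite /= count_nseq /=.
rewrite sumnE big_map.
have mem_rs : (x \in polyrcf.rootsR (char_poly M)) = root (char_poly M) x.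
  by rewrite -(polyrcf.roots_on_rootsR char0).
(* [rootsR] has no repetition, so only the block of [x] contributes; for a non-root both counts are
   0. *)
have [rx|nrx] := boolP (root (char_poly M) x).
  rewrite (bigD1_seq x) ?mem_rs //= eqxx mul1n big1 ?addn0 // => y.
  by move=> /negPf->.
rewrite mupNroot // big1_seq // => y /= yrs.
have [yx|//] := eqVneq y x.
by rewrite yx mem_rs (negPf nrx) in yrs.
Qed.

(* Indexed from 1, in decreasing order, as [sigma]. *)
Definition eigen n (M : 'M[R]_n) (i : nat) : R :=
  nth 0 (sort >=%R (eigenvals M)) i.-1.

(** Reduces every later inequality on eigenvalues to exhibiting a subspace. *)
Lemma eigen_geP n (M : 'M[R]_n) i t : M^T = M -> (1 <= i <= n)%N ->
  t <= eigen M i <-> rayleigh_ge (toC M) i t%:C%C.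
Proof.
move=> MT /andP[i1 ile]; have Mh := toC_hermsym MT.
have pe := eigenvals_spectral MT.
rewrite rayleigh_geP //; last by rewrite complex_real.
rewrite /eigen nth_sort_ge; last first.
  by rewrite (perm_size pe) size_map size_enum_ord prednK.
rewrite prednK // (permP pe) count_map cardE -size_filter.
suff /eq_filter-> : preim (fun j => complex.Re (spectral_diag (toC M) 0 j))
    (>= t)%R =1 [pred j | t%:C%C <= spectral_diag (toC M) 0 j].
  by rewrite [enum 'I_n]enumT.
move=> j /=.
have /complex_realP[x ->] := mxOverP (hermitian_spectral_diag_real Mh) 0 j.
by rewrite /= lecR.
Qed.

(** The square root is monotone, so it commutes with sorting, and the truncation does not reach
    index [i]. *)
Lemma sigmaE p q (X : 'M[R]_(p, q)) i : (1 <= i <= minn p q)%N ->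
  sigma X i = Num.sqrt (eigen (X^T *m X) i).
Proof.
move=> /andP[i1 ile]; rewrite /sigma /singular_values nth_take ?prednK //.
rewrite /eigen; set s := eigenvals _.
have -> : sort >=%R [seq Num.sqrt x | x <- s] = map Num.sqrt (sort >=%R s).
  apply: (@sorted_eq _ >=%R) => //.
  - exact: ge_trans.
  - exact: ge_anti.
  - exact/sort_sorted/ge_total.
  - rewrite sorted_map; apply: sub_sorted (sort_sorted (@ge_total _ R) s).
    by move=> x y /=; exact: ler_wsqrtr.
  - by rewrite perm_sort perm_map // perm_sym perm_sort.
(* Past the end of the list both sides take the default value, and sqrt 0 = 0. *)
have [si|si] := ltnP i.-1 (size (sort >=%R s)).
  by rewrite (nth_map 0).
by rewrite !nth_default ?size_map // sqrtr0.
Qed.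

(** A crude Weyl inequality, from perturbing the subspace bound at the threshold [eigen M i].
    Exchanging the matrices gives the other side. *)
Lemma eigen_perturb n (M M' : 'M[R]_n) e i : M^T = M -> M'^T = M' ->
  (1 <= i <= n)%N -> (forall a b, `|M a b - M' a b| <= e) ->
  eigen M i - n%:R * e <= eigen M' i.
Proof.
move=> MT MT' ile MM'; apply/eigen_geP => //.
rewrite rmorphB rmorphM rmorph_nat /=.
apply: (@rayleigh_ge_perturb _ _ (toC M)); first exact: toC_hermsym.
- exact: toC_hermsym.
- move=> a b; rewrite !mxE -rmorphB normc_def /= expr0n addr0 sqrtr_sqr.
  by rewrite lecR.
- exact/eigen_geP.
Qed.

Lemma gram_sym m n (X : 'M[R]_(m, n)) : (X^T *m X)^T = X^T *m X.
Proof. by rewrite trmx_mul trmxK. Qed.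

Lemma eigen_gram_ge0 m n (X : 'M[R]_(m, n)) i : (1 <= i <= n)%N ->
  0 <= eigen (X^T *m X) i.
Proof.
move=> /[dup] ile /andP[_ le_in]; apply/eigen_geP => //; first exact: gram_sym.
by rewrite map_mxM -toC_conj; exact: rayleigh_ge_gram0.
Qed.

(** A positive eigenvalue, taken as its own threshold, would force [i] to be at most the rank. *)
Lemma eigen_gram_rank m n (X : 'M[R]_(m, n)) i : (\rank X < i <= n)%N ->
  eigen (X^T *m X) i = 0.
Proof.
move=> /andP[rX le_in].
have ile : (1 <= i <= n)%N by rewrite le_in andbT (leq_ltn_trans _ rX).
apply/eqP; rewrite eq_le eigen_gram_ge0 // andbT leNgt; apply/negP => e0.
have /(eigen_geP _ (gram_sym X) ile) := lexx (eigen (X^T *m X) i).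
rewrite map_mxM -toC_conj => /rayleigh_ge_rank.
by rewrite mxrank_map leqNgt rX ltcR => /(_ e0).
Qed.

Lemma eigen_gram_blowup m n N (A : 'M[R]_(m, n)) (J : 'M[R]_(n, N)) k i :
  0 < k -> J *m J^T = k%:M -> (1 <= i <= minn n N)%N ->
  eigen ((A *m J)^T *m (A *m J)) i = k * eigen (A^T *m A) i.
Proof.
move=> k0 JJ; rewrite leq_min andbA => /andP[/[dup] ile /andP[i1 _] le_iN].
have ileN : (1 <= i <= N)%N by rewrite i1.
have kC0 : 0 < k%:C%C :> complex R by rewrite ltcR.
have JJC : toC J *m (toC J)^t* = (k%:C%C)%:M.
  by rewrite toC_conj -map_mxM JJ map_scalar_mx.
have GE : toC ((A *m J)^T *m (A *m J)) = (toC J)^t* *m toC (A^T *m A) *m toC J.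
  by rewrite toC_conj -!map_mxM trmx_mul !mulmxA.
apply: le_anti; apply/andP; split; last first.
  apply/eigen_geP => //; first exact: gram_sym.
  rewrite GE rmorphM; apply: rayleigh_ge_blowup => //.
  by apply/eigen_geP => //; exact: gram_sym.
(* Pulling back a subspace requires a positive threshold; otherwise the bound holds as the right
   side is nonnegative. *)
have [t0|t0] := lerP (eigen ((A *m J)^T *m (A *m J)) i) 0.
  by apply: le_trans t0 _; rewrite mulr_ge0 ?(ltW k0) ?eigen_gram_ge0.
rewrite mulrC -ler_pdivrMr //; apply/eigen_geP => //; first exact: gram_sym.
rewrite fmorph_div; apply: (@rayleigh_ge_blowup_inv _ _ _ _ (toC J)) => //.
  by rewrite ltcR.
by rewrite -GE; apply/eigen_geP => //; exact: gram_sym.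
Qed.

Lemma cvg_eigen (T : Type) (F : set_system T) (FF : Filter F) n
    (M : T -> 'M[R]_n) (M0 : 'M[R]_n) i :
  (forall x, (M x)^T = M x) -> M0^T = M0 -> (1 <= i <= n)%N ->
  (forall a b, M x a b @[x --> F] --> M0 a b) ->
  eigen (M x) i @[x --> F] --> eigen M0 i.
Proof.
move=> MT MT0 ile cvgM; apply/cvgrPdist_le => e e0.
have n0 : 0 < n%:R :> R.
  by rewrite ltr0n; case/andP: ile => i1; exact: leq_trans.
(* Finitely many entries allow one common neighbourhood; the tolerance e / n offsets the factor n of
   [eigen_perturb]. *)
have /filter_forall near_ab : forall a, \forall x \near F, forall b,
    `|M0 a b - M x a b| <= e / n%:R.
  move=> a; apply: filter_forall => b.
  by move/cvgrPdist_le : (cvgM a b); apply; rewrite divr_gt0.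
apply: filterS near_ab => x Mx.
have Mx' a b : `|M x a b - M0 a b| <= e / n%:R by rewrite distrC.
have := eigen_perturb MT0 (MT x) ile Mx.
have := eigen_perturb (MT x) MT0 ile Mx'.
rewrite mulrCA divff ?gt_eqF // mulr1 => h1 h2.
by rewrite ler_distlC h2 /= -lerBlDr.
Qed.

Lemma cvg_sigma (T : Type) (F : set_system T) (FF : Filter F) p q
    (X : T -> 'M[R]_(p, q)) (X0 : 'M[R]_(p, q)) i : (1 <= i <= minn p q)%N ->
  (forall a b, X x a b @[x --> F] --> X0 a b) ->
  sigma (X x) i @[x --> F] --> sigma X0 i.
Proof.
move=> ile cvgX; rewrite sigmaE //; under eq_fun => x do rewrite sigmaE //.
apply: cvg_comp; last exact: sqrt_continuous.
apply: cvg_eigen => [x|||a b]; [exact: gram_sym|exact: gram_sym| |].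
  by move: ile; rewrite leq_min => /and3P[-> _ ->].
rewrite mxE; under eq_fun => x do rewrite mxE.
apply: cvg_big => [|c _]; first exact: add_continuous.
rewrite mxE; under eq_fun => x do rewrite mxE.
exact: cvgM.
Qed.

Lemma sigma_rank p q (X : 'M[R]_(p, q)) i : (\rank X < i <= minn p q)%N ->
  sigma X i = 0.
Proof.
move=> /andP[rX ile]; rewrite sigmaE ?ile ?andbT ?(leq_ltn_trans _ rX) //.
rewrite eigen_gram_rank ?sqrtr0 // rX /=.
by move: ile; rewrite leq_min => /andP[].
Qed.

Lemma sigma_blowup m n N (A : 'M[R]_(m, n)) (J : 'M[R]_(n, N)) k i :
  0 < k -> J *m J^T = k%:M -> (1 <= i)%N -> (i <= m)%N -> (i <= n)%N ->
  (i <= N)%N ->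
  sigma (A *m J) i = Num.sqrt k * sigma A i.
Proof.
move=> k0 JJ i1 im in_ iN.
rewrite !sigmaE ?leq_min ?i1 ?im ?in_ //.
by rewrite (eigen_gram_blowup _ k0 JJ) ?leq_min ?i1 ?in_ // sqrtrM // ltW.
Qed.

End RealSymmetric.

(** * Entries are bounded by the spectral norm *)

Section SpectralNorm.
Variable R : realType.

Lemma entry_le_norm2 q (v : 'cV[R]_q) j : `|v j 0| <= norm2 v.
Proof.
rewrite -sqrtr_sqr ler_sqrt ?sumr_ge0 // => [|i _]; last exact: sqr_ge0.
rewrite (bigD1 j) //= lerDl sumr_ge0 // => i _; exact: sqr_ge0.
Qed.

Lemma norm2_le_sum q (v : 'cV[R]_q) : norm2 v <= \sum_i `|v i 0|.
Proof.
rewrite -[leRHS]ger0_norm ?sumr_ge0 // -sqrtr_sqr ler_sqrt ?sqr_ge0 //.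
rewrite expr2 mulr_suml; apply: ler_sum => i _.
rewrite -real_normK ?num_real // expr2 ler_wpM2l //.
by rewrite (bigD1 i) //= lerDl sumr_ge0.
Qed.

(** The entry is a coordinate of the image of the unit vector e_b. *)
Lemma entry_le_spectral_norm p q (X : 'M[R]_(p, q)) a b :
  `|X a b| <= spectral_norm X.
Proof.
pose v : 'cV[R]_q := delta_mx b 0.
apply: (@le_trans _ _ (norm2 (X *m v))).
  by rewrite -colE; apply: le_trans (entry_le_norm2 _ a); rewrite mxE.
apply: ub_le_sup; last first.
  exists v => //=; rewrite /norm2 (bigD1 b) //= big1 ?addr0.
    by rewrite mxE !eqxx expr1n sqrtr1.
  by move=> i /negPf ib; rewrite mxE ib expr0n.
(* The supremum is meaningful only for a bounded set: vectors of the unit ball have entries of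
   modulus at most 1. *)
exists (\sum_i \sum_j `|X i j|) => _ [w /= w1 <-].
apply: le_trans (norm2_le_sum _) _; apply: ler_sum => i _.
rewrite mxE; apply: le_trans (ler_norm_sum _ _ _) _; apply: ler_sum => j _.
by rewrite normrM ler_piMr // (le_trans (entry_le_norm2 w j)).
Qed.

End SpectralNorm.

(** * Block structure of the concatenation *)

Section Concatenation.
Variables (R : realType) (m n k : nat).

(** The block and column are chosen before [B], so they are the same for the perturbed and the limit
    matrix. *)
Lemma hconcat_entry (a : 'I_m) (b : 'I_(k * n)) :
  exists j c, forall B : 'I_k -> 'M[R]_(m, n), hconcat B a b = B j a c.
Proof.
(* Once the width proof is generalized, eliminating the equality makes the cast trivial. *)
rewrite /hconcat; move: (sum_ord_const k n) b.
case: (k * n)%N / => b; eexists; eexists => B.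
by rewrite castmx_id mxE; reflexivity.
Qed.

Lemma hconcat_const (A : 'M[R]_(m, n)) :
  hconcat (fun _ : 'I_k => A) = A *m hconcat (fun _ : 'I_k => 1%:M).
Proof.
rewrite /hconcat; move: (sum_ord_const k n); case: (k * n)%N /.
rewrite !castmx_id mul_mxrow.
by apply: eq_mxrow => j; rewrite mulmx1.
Qed.

End Concatenation.

Lemma hconcat1_gram (R : realType) n k :
  hconcat (fun _ : 'I_k => 1%:M : 'M[R]_n) *m
  (hconcat (fun _ : 'I_k => 1%:M : 'M[R]_n))^T = k%:R%:M.
Proof.
rewrite /hconcat; move: (sum_ord_const k n); case: (k * n)%N /.
rewrite !castmx_id tr_mxrow mul_mxrow_mxcol.
under eq_bigr do rewrite trmx1 mulmx1.
by rewrite sumr_const card_ord -raddfMn.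
Qed.

(** * The two limits *)

Theorem corollary2 (R : realType) (m n k : nat)
    (hm : (1 <= m)%N) (hn : (1 <= n)%N) (hk : (1 <= k)%N)
    (A : 'M[R]_(m, n)) (E : R -> nat -> 'M[R]_(m, n))
    (hE : forall e : R, 0 < e ->
      forall j : nat, (2 <= j <= k)%N -> spectral_norm (E e j) < e) :
  (forall i : nat, (1 <= i <= \rank A)%N ->
    sigma (perturbed_concat k A (E e)) i @[e --> (0 : R)^'+]
      --> Num.sqrt (k%:R : R) * sigma A i) /\
  (forall i : nat, (\rank A + 1 <= i <= minn m (k * n))%N ->
    sigma (perturbed_concat k A (E e)) i @[e --> (0 : R)^'+] --> (0 : R)).
Proof.
(* Both claims reduce to computing the singular values of [A, ..., A]. *)
have cvgX i : (1 <= i <= minn m (k * n))%N ->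
    sigma (perturbed_concat k A (E e)) i @[e --> (0 : R)^'+] -->
    sigma (hconcat (fun _ : 'I_k => A)) i.
  move=> ile; apply: cvg_sigma => // a b.
  have [j [c BE]] := hconcat_entry R a b.
  rewrite BE; under eq_fun => e do rewrite /perturbed_concat BE.
  have [j0|j0] := eqVneq (j : nat) 0%N; first exact: cvg_cst.
  have cvgE : E e j.+1 a c @[e --> (0 : R)^'+] --> (0 : R).
    apply/cvgrPdist_le => d d0; near=> e.
    rewrite sub0r normrN; apply: le_trans (entry_le_spectral_norm _ _ _) _.
    have e0 : 0 < e by near: e; exact: nbhs_right_gt.
    apply: le_trans (ltW (hE e e0 _ _)) _.
      by rewrite ltnS lt0n j0 ltn_ord.
    by near: e; exact: nbhs_right_le.
  under eq_fun => e do rewrite mxE.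
  by have := cvgD (cvg_cst (A a c)) cvgE; rewrite addr0; apply.
have k0 : 0 < k%:R :> R by rewrite ltr0n.
split=> i /andP[i1 ile].
  have im := leq_trans ile (rank_leq_row A).
  have in_ := leq_trans ile (rank_leq_col A).
  have ikn : (i <= k * n)%N by exact: leq_trans in_ (leq_pmull _ hk).
  have := cvgX i; rewrite i1 leq_min im ikn => /(_ isT).
  rewrite hconcat_const.
  by rewrite (sigma_blowup A k0 (hconcat1_gram R n k) i1 im in_ ikn).
have ri : (\rank A < i)%N by rewrite -addn1.
have := cvgX i; rewrite ile andbT (leq_ltn_trans _ ri) // => /(_ isT).
(* Here [i] may exceed n, outside the range of [sigma_blowup]; rank(AJ) <= rank(A) suffices. *)
rewrite hconcat_const sigma_rank // ile andbT.
exact: leq_ltn_trans (mxrankM_maxl _ _) ri.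
Unshelve. all: by end_near.
Qed.
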